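(* Let $F$ be a free group of finite rank $r\ge 1$ with free basis $X=\{x_1,\ldots,x_r\}$, let $N$ be a normal subgroup of $F$ and let $N'=[N,N]$. Let $\varphi : F/N' \hookrightarrow \mathbb{Z}^r \wr F/N$ be the Magnus embedding. Let $d_{F/N'}$ be the word metric on $F/N'$ with respect to the images of $x_1,\ldots,x_r$, and let $d_M$ be the word metric on $\mathbb{Z}^r\wr F/N$ with respect to the generating set consisting of the elements $(1,x_iN)$ and $(e_i,\mathrm{Id}_{F/N})$ for $i=1,\ldots,r$ (notation as in the context). Then $\varphi$ is $2$-bi-Lipschitz; precisely, for every $g\in F/N'$, $$\frac{1}{2}\, d_{F/N'}(\mathrm{Id}_{F/N'},g)\ \le\ d_M(\mathrm{Id}_M,\varphi(g))\ \le\ 2\, d_{F/N'}(\mathrm{Id}_{F/N'},g),$$ where $\mathrm{Id}_M$ is the identity of $\mathbb{Z}^r\wr F/N$.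
   Context: Wreath product: for groups $A,B$, let $A^{(B)}$ be the group (under pointwise multiplication) of functions $B\to A$ with finite support. The restricted wreath product $A\wr B=A^{(B)}\rtimes B$ consists of pairs $(f,b)$, $f\in A^{(B)}$, $b\in B$, with multiplication $(f,b)(g,c)=(fg^b,bc)$, where $g^b(x)=g(b^{-1}x)$. The trivial function is denoted $1$. For $A=\mathbb{Z}^r$ and $B=F/N$, $e_i$ denotes the function $F/N\to\mathbb{Z}^r$ taking the $i$-th standard basis vector as its value at $\mathrm{Id}_{F/N}$ and $0$ elsewhere. Word metrics are left-invariant: $d(x,y)=|x^{-1}y|$, where $|\cdot|$ is word length over the generators and their inverses. Fox derivatives: for each $i$, $\frac{\partial}{\partial x_i}:\mathbb{Z}(F)\to\mathbb{Z}(F)$ is the unique additive map with $\frac{\partial (ab)}{\partial x_i}=\frac{\partial a}{\partial x_i}\varepsilon(b)+a\frac{\partial b}{\partial x_i}$ for all $a,b\in \mathbb{Z}(F)$ and $\frac{\partial x_j}{\partial x_i}=\delta_{ij}\mathrm{Id}_F$, where $\varepsilon:\mathbb{Z}(F)\to\mathbb{Z}$ is the additive homomorphism sending each element of $F$ to $1$. Let $\theta:F\to F/N$ be the quotient homomorphism, $\theta^\star:\mathbb{Z}(F)\to\mathbb{Z}(F/N)$ its extension to group rings, and $\frac{\partial^\star w}{\partial x_i}=\theta^\star\big(\frac{\partial w}{\partial x_i}\big)\in\mathbb{Z}(F/N)$. Magnus embedding: for $w\in F$, let $f^{(w)}=(f_1^{(w)},\ldots,f_r^{(w)}):F/N\to\mathbb{Z}^r$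 be the finitely supported function determined by $\sum_{g\in F/N}f_i^{(w)}(g)\,g=\frac{\partial^\star w}{\partial x_i}$ for each $i$. The map $w\mapsto(f^{(w)},\theta(w))$ is a homomorphism $F\to\mathbb{Z}^r\wr F/N$ with kernel $N'$ (Magnus); the induced injective homomorphism $\varphi:F/N'\to\mathbb{Z}^r\wr F/N$ is the Magnus embedding. (Equivalently, with $\mathcal{R}$ the free $\mathbb{Z}(F/N)$-module on $t_1,\ldots,t_r$, $\varphi(w)=\begin{pmatrix}\theta(w)&\sum_i\frac{\partial^\star w}{\partial x_i}t_i\\0&1\end{pmatrix}$ in the group of matrices $\begin{pmatrix}g&a\\0&1\end{pmatrix}$, $g\in F/N$, $a\in\mathcal{R}$.) *)

(* Defs.v *)
From HB Require Import structures.
From mathcomp Require Import all_boot all_order all_algebra.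
From mathcomp Require Import boolp classical_sets.
From mathcomp Require Import finmap.
From mathcomp.multinomials Require Import monalg.

Set Implicit Arguments.
Unset Strict Implicit.
Unset Printing Implicit Defensive.

Import GRing.Theory Num.Theory.

Local Open Scope classical_set_scope.
Local Open Scope ring_scope.
Local Open Scope quotient_scope.

Definition free_basis (r : nat) (F : groupType) (x : 'I_r -> F) : Prop :=
  forall (G : groupType) (a : 'I_r -> G),
    exists! h : F -> G,
      {morph h : u v / (u * v)%g} /\ forall i, h (x i) = a i.

Section NormalSubgroups.
Variable F : groupType.
Implicit Types (H : set F) (g h : F).

Definition is_subgroup H : Prop :=
  [/\ H 1%g, forall g h, H g -> H h -> H (g * h)%g & forall g, H g -> H g^-1%g].

Record normalSubgroup := NormalSubgroup {
  normal_carrier :> F -> Prop;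
  normal_is_subgroup : is_subgroup normal_carrier;
  normalJ : forall g h, normal_carrier g -> normal_carrier (g ^ h)%g }.

Variable N : normalSubgroup.

Lemma normal1 : N 1%g. Proof. by case: (normal_is_subgroup N). Qed.
Lemma normalM g h : N g -> N h -> N (g * h)%g.
Proof. by case: (normal_is_subgroup N) => _ + _; apply. Qed.
Lemma normalV g : N g -> N g^-1%g.
Proof. by case: (normal_is_subgroup N) => _ _; apply. Qed.

Definition derived_set : set F :=
  smallest is_subgroup [set g | exists a b, [/\ N a, N b & g = [~ a, b]%g]].

Lemma derived_is_subgroup : is_subgroup derived_set.
Proof.
split=> [M [[]]//|g h Dg Dh M MP|g Dg M MP].
  by case: (MP.1) => _ + _; apply; [apply: Dg|apply: Dh].
by case: (MP.1) => _ _; apply; apply: Dg.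
Qed.

Lemma derivedJ g h : derived_set g -> derived_set (g ^ h)%g.
Proof.
have [D1 DM DV] := derived_is_subgroup.
apply: (@smallest_sub _ _ _ [set y | derived_set (y ^ h)%g]) => [|y /=].
  split=> [|u v|u] /=.
  - by rewrite conj1g.
  - by rewrite conjMg; apply: DM.
  - by rewrite conjVg; apply: DV.
move=> [a [b [Na Nb ->]]]; rewrite conjRg => M [_]; apply => /=.
by exists (a ^ h)%g, (b ^ h)%g; split=> //; apply: normalJ.
Qed.

Definition derived_subgroup : normalSubgroup :=
  NormalSubgroup derived_is_subgroup derivedJ.

Definition coset_rel : rel F := fun g h => `[< N (g^-1 * h)%g >].

Lemma coset_rel_refl : reflexive coset_rel.
Proof. by move=> g; apply/asboolP; rewrite mulVg; apply: normal1. Qed.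

Lemma coset_rel_sym : symmetric coset_rel.
Proof.
suff H g h : coset_rel g h -> coset_rel h g by move=> g h; apply/idP/idP; apply: H.
by move=> /asboolP/normalV Ngh; apply/asboolP; rewrite invgM invgK in Ngh.
Qed.

Lemma coset_rel_trans : transitive coset_rel.
Proof.
move=> h g k /asboolP Ngh /asboolP Nhk; apply/asboolP.
by have := normalM Ngh Nhk; rewrite mulgA mulgK.
Qed.

Canonical coset_equiv :=
  EquivRel coset_rel coset_rel_refl coset_rel_sym coset_rel_trans.

Definition quotient_group := {eq_quot coset_equiv}.
HB.instance Definition _ := Choice.on quotient_group.
HB.instance Definition _ := Quotient.on quotient_group.

Definition proj (g : F) : quotient_group := \pi_quotient_group g.

Lemma proj_eqP g h : proj g = proj h <-> N (g^-1 * h)%g.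
Proof.
by split=> [/eqmodP/asboolP//|Ngh]; apply/eqmodP/asboolP.
Qed.

Lemma repr_projP g : N ((repr (proj g))^-1 * g)%g.
Proof. by apply/proj_eqP; rewrite /proj reprK. Qed.

Definition quotient_mul (p q : quotient_group) : quotient_group := proj (repr p * repr q)%g.
Definition quotient_inv (p : quotient_group) : quotient_group := proj (repr p)^-1%g.

Lemma proj_surj (p : quotient_group) : exists g, p = proj g.
Proof. by exists (repr p); rewrite /proj reprK. Qed.

Lemma quotient_mulE g h : quotient_mul (proj g) (proj h) = proj (g * h)%g.
Proof.
apply/proj_eqP; set g' := repr _; set h' := repr _.
rewrite (_ : _ * _ = ((g'^-1 * g) ^ h') * (h'^-1 * h))%g; last first.
  by rewrite conjgE invgM !mulgA mulgK.
by apply: normalM; [apply: normalJ|]; apply: repr_projP.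
Qed.

Lemma quotient_invE g : quotient_inv (proj g) = proj g^-1%g.
Proof.
apply/proj_eqP; set g' := repr _; rewrite invgK.
rewrite (_ : _ / _ = ((g'^-1 * g)^-1) ^ g'^-1)%g.
  by apply/normalJ/normalV/repr_projP.
by rewrite conjgE invgM !invgK mulgK.
Qed.

Lemma quotient_mulA : associative quotient_mul.
Proof.
move=> p q s; have [g ->] := proj_surj p; have [h ->] := proj_surj q.
by have [k ->] := proj_surj s; rewrite !quotient_mulE mulgA.
Qed.
Lemma quotient_mul1 : left_id (proj 1%g) quotient_mul.
Proof. by move=> p; have [g ->] := proj_surj p; rewrite quotient_mulE mul1g. Qed.
Lemma quotient_mulr1 : right_id (proj 1%g) quotient_mul.
Proof. by move=> p; have [g ->] := proj_surj p; rewrite quotient_mulE mulg1. Qed.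
Lemma quotient_mulV : left_inverse (proj 1%g) quotient_inv quotient_mul.
Proof.
by move=> p; have [g ->] := proj_surj p; rewrite quotient_invE quotient_mulE mulVg.
Qed.
Lemma quotient_mulrV : right_inverse (proj 1%g) quotient_inv quotient_mul.
Proof.
by move=> p; have [g ->] := proj_surj p; rewrite quotient_invE quotient_mulE mulgV.
Qed.

HB.instance Definition _ := isGroup.Build quotient_group quotient_mulA quotient_mul1
  quotient_mulr1 quotient_mulV quotient_mulrV.

Lemma projM : {morph proj : g h / (g * h)%g}.
Proof. by move=> g h; rewrite -quotient_mulE. Qed.

End NormalSubgroups.

(* Functions of finite support B -> A are represented by {malg A[B]}. *)
Section WreathProduct.
Variables (A : zmodType) (B : groupType).
Implicit Types (f g : {malg A[B]}) (b c : B).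

Definition translate b g : {malg A[B]} :=
  [malg y in [fset (b * z)%g | z in msupp g]%fset => g@_(b^-1 * y)%g].

Lemma translateE b g y : (translate b g)@_y = g@_(b^-1 * y)%g.
Proof.
rewrite mcoeffE; case: ifPn => // yN; rewrite mcoeff_outdom //.
apply: contra yN => ygs; apply/imfsetP; exists (b^-1 * y)%g => //=.
by rewrite mulVKg.
Qed.

Lemma translateD b : {morph translate b : f g / f + g}.
Proof. by move=> f g; apply/malgP => y; rewrite mcoeffD !translateE mcoeffD. Qed.

Lemma translate1 f : translate 1%g f = f.
Proof. by apply/malgP => y; rewrite translateE invg1 mul1g. Qed.

Lemma translateM b c f : translate (b * c)%g f = translate b (translate c f).
Proof. by apply/malgP => y; rewrite !translateE invgM mulgA. Qed.

Lemma translate0 b : translate b 0 = 0.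
Proof. by apply/malgP => y; rewrite !translateE !mcoeff0. Qed.

Lemma translateN b f : translate b (- f) = - translate b f.
Proof. by apply/malgP => y; rewrite mcoeffN !translateE mcoeffN. Qed.

Lemma translateU b c (a : A) : translate b << a *g c >> = << a *g (b * c)%g >>.
Proof.
apply/malgP => y; rewrite translateE !mcoeffU; congr (_ *+ nat_of_bool _).
by apply/eqP/eqP => [->|<-]; rewrite ?mulVKg ?mulKg.
Qed.

Definition wreath := ({malg A[B]} * B)%type.
HB.instance Definition _ := Choice.on wreath.

Definition wreath_mul (p q : wreath) : wreath :=
  (p.1 + translate p.2 q.1, (p.2 * q.2)%g).
Definition wreath_one : wreath := (0, 1%g).
Definition wreath_inv (p : wreath) : wreath :=
  (- translate p.2^-1%g p.1, p.2^-1%g).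

Lemma wreath_mulA : associative wreath_mul.
Proof.
move=> [f b] [g c] [h d]; rewrite /wreath_mul /=.
by rewrite translateD translateM addrA mulgA.
Qed.
Lemma wreath_mul1 : left_id wreath_one wreath_mul.
Proof. by move=> [f b]; rewrite /wreath_mul /= translate1 add0r mul1g. Qed.
Lemma wreath_mulr1 : right_id wreath_one wreath_mul.
Proof. by move=> [f b]; rewrite /wreath_mul /= translate0 addr0 mulg1. Qed.
Lemma wreath_mulV : left_inverse wreath_one wreath_inv wreath_mul.
Proof. by move=> [f b]; rewrite /wreath_mul /= addNr mulVg. Qed.
Lemma wreath_mulrV : right_inverse wreath_one wreath_inv wreath_mul.
Proof.
move=> [f b]; rewrite /wreath_mul /= translateN -translateM mulgV translate1.
by rewrite subrr.
Qed.

HB.instance Definition _ := isGroup.Build wreath wreath_mulA wreath_mul1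
  wreath_mulr1 wreath_mulV wreath_mulrV.

Lemma wreathM (p q : wreath) :
  (p * q)%g = (p.1 + translate p.2 q.1, (p.2 * q.2)%g) :> wreath.
Proof. by []. Qed.

End WreathProduct.

(* The group ring Z(G) is represented by {malg int[G]}, with g : G embedded   *)
(* as << g >>; its product is the bi-additive extension of that of G.         *)
Section GroupRing.
Variable G : groupType.

Definition additive_ext (V : zmodType) (h : G -> V) (a : {malg int[G]}) : V :=
  \sum_(k <- msupp a) h k *~ a@_k.

Lemma additive_extEw (V : zmodType) (h : G -> V) (a : {malg int[G]})
    (d : {fset G}) : (msupp a `<=` d)%fset ->
  additive_ext h a = \sum_(k <- d) h k *~ a@_k.
Proof.
move=> ad; rewrite /additive_ext (big_fset_incl _ ad) //= => k _ kNa.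
by rewrite mcoeff_outdom.
Qed.

Lemma additive_extD (V : zmodType) (h : G -> V) :
  {morph additive_ext h : a b / a + b}.
Proof.
move=> a b; set d := (msupp a `|` msupp b)%fset.
rewrite (@additive_extEw _ h (a + b) d) ?msuppD_le //.
rewrite (@additive_extEw _ h a d) ?fsubsetUl //.
rewrite (@additive_extEw _ h b d) ?fsubsetUr // -big_split /=.
by apply: eq_bigr => k _; rewrite mcoeffD mulrzDr.
Qed.

Lemma additive_extU (V : zmodType) (h : G -> V) (g : G) :
  additive_ext h << g >> = h g.
Proof.
rewrite (@additive_extEw _ _ _ [fset g]%fset) ?msuppU_le //.
by rewrite big_seq_fset1 mcoeffUU.
Qed.

Lemma additive_extDl (V : zmodType) (h1 h2 : G -> V) (a : {malg int[G]}) :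
  additive_ext (fun g => h1 g + h2 g) a = additive_ext h1 a + additive_ext h2 a.
Proof. by rewrite -big_split; apply: eq_bigr => k _; rewrite mulrzDl. Qed.

Lemma eq_additive (V : zmodType) (f1 f2 : {malg int[G]} -> V) :
  {morph f1 : a b / a + b} -> {morph f2 : a b / a + b} ->
  (forall g, f1 << g >> = f2 << g >>) -> f1 =1 f2.
Proof.
have f0 (f : {malg int[G]} -> V) : {morph f : a b / a + b} -> f 0 = 0.
  by move=> fD; apply: (addrI (f 0)); rewrite -fD !addr0.
have fMz (f : {malg int[G]} -> V) a z :
    {morph f : a b / a + b} -> f (a *~ z) = f a *~ z.
  move=> fD; have fN b : f (- b) = - f b.
    by apply/eqP; rewrite -addr_eq0 -fD addNr f0.
  case: z => n; rewrite ?NegzE ?mulrNz ?fN; last congr (- _).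
    by elim: n => [|n IH]; rewrite ?f0 // -!pmulrn !mulrS fD !pmulrn IH.
  by rewrite -!pmulrn; elim: n.+1 => [|m IH]; rewrite ?f0 // !mulrS fD IH.
move=> f1D f2D f12 a; rewrite (monalgE a).
elim: (finmap.enum_fset _) => [|k s IH]; first by rewrite !big_nil !f0.
rewrite !big_cons f1D f2D IH; congr (_ + _).
have -> : << a@_k *g k >> = << k >> *~ a@_k.
  by rewrite -{1}[a@_k]intz -(raddfMz (mkmalgU k)).
by rewrite !fMz // f12.
Qed.

Definition gring_mul (a b : {malg int[G]}) : {malg int[G]} :=
  additive_ext (fun g => additive_ext (fun h => << (g * h)%g >>) b) a.

Lemma gring_mulDl b : {morph gring_mul^~ b : a a' / a + a'}.
Proof. exact: additive_extD. Qed.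

Lemma gring_mulDr a : {morph gring_mul a : b b' / b + b'}.
Proof.
move=> b b'; rewrite -additive_extDl; congr (additive_ext _ a).
by apply/funext => g; rewrite additive_extD.
Qed.

Lemma gring_mulUl g b : gring_mul << g >> b = translate g b.
Proof.
move: b; apply: eq_additive => [||h].
- exact: gring_mulDr.
- exact: translateD.
- by rewrite /gring_mul !additive_extU translateU.
Qed.

Definition augmentation : {malg int[G]} -> int := additive_ext (fun=> 1).

End GroupRing.

Definition gring_map (G H : groupType) (h : G -> H) :
    {malg int[G]} -> {malg int[H]} :=
  additive_ext (fun g => << h g >>).

Section FoxDerivatives.
Variables (r : nat) (F : groupType) (x : 'I_r -> F).

Definition is_fox_derivative (i : 'I_r)
    (D : {malg int[F]} -> {malg int[F]}) : Prop :=
  [/\ {morph D : a b / a + b},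
      forall a b,
        D (gring_mul a b) = D a *~ augmentation b + gring_mul a (D b)
    & forall j, D << x j >> = if j == i then << 1%g >> else 0].

(* The function satisfying is_fox_derivative; it exists and is unique when    *)
(* x is a free basis, see fox_derivativeP and fox_derivative_unique.          *)
Definition fox_derivative (i : 'I_r) : {malg int[F]} -> {malg int[F]} :=
  xget (fun=> 0) (is_fox_derivative i).

Hypothesis x_free : free_basis x.

Lemma fox_derivativeU i D u v : is_fox_derivative i D ->
  D << (u * v)%g >> = D << u >> + translate u (D << v >>).
Proof.
case=> _ DM _; have := DM << u >> << v >>.
by rewrite !gring_mulUl translateU /augmentation additive_extU mulr1z.
Qed.

Lemma fox_derivative_unique i D D' :
  is_fox_derivative i D -> is_fox_derivative i D' -> D =1 D'.
Proof.
move=> DP D'P; have [[Dadd _ Dx] [D'add _ D'x]] := (DP, D'P).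
apply: eq_additive => // w.
have [h [_ hU]] := x_free (G := wreath int F)
  (fun j => (if j == i then << 1%g >> else 0, x j)).
pose lift (E : {malg int[F]} -> {malg int[F]}) (u : F) : wreath int F :=
  (E << u >>, u).
have /(congr1 (fun k => (k w).1)) : lift D = lift D'; last by [].
rewrite -(hU (lift D)); last first.
  by split=> [u v|j]; rewrite /lift ?Dx // (fox_derivativeU _ _ DP).
apply: hU; split=> [u v|j]; rewrite /lift ?D'x //.
by rewrite (fox_derivativeU _ _ D'P).
Qed.

Lemma fox_derivativeP i : is_fox_derivative i (fox_derivative i).
Proof.
rewrite /fox_derivative; apply: xgetPex.
have [h [[hM hx] _]] := x_free (G := wreath int F)
  (fun j => (if j == i then << 1%g >> else 0, x j)).
have h2 w : (h w).2 = w.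
  have [k [_ kU]] := x_free x.
  rewrite -[LHS]/((snd \o h) w) -(kU (snd \o h)) ?(kU id) //.
  by split=> [u v|j] /=; rewrite ?hM ?hx.
have h1M u v : (h (u * v)%g).1 = (h u).1 + translate u (h v).1.
  by rewrite hM wreathM /= h2.
exists (additive_ext (fun w => (h w).1)); split.
- exact: additive_extD.
- move=> a b; move: a; apply: eq_additive.
  + by move=> a a'; rewrite gring_mulDl additive_extD.
  + by move=> a a'; rewrite additive_extD gring_mulDl mulrzDl addrACA.
  move=> g; move: b; apply: eq_additive.
  + by move=> b b'; rewrite gring_mulDr additive_extD.
  + move=> b b'; rewrite /augmentation !additive_extD gring_mulDr mulrzDr.
    by rewrite addrACA.
  move=> g'; rewrite !gring_mulUl translateU /augmentation !additive_extU.
  by rewrite mulr1z h1M.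
- by move=> j; rewrite additive_extU hx.
Qed.

End FoxDerivatives.

Section MagnusEmbedding.
Variables (r : nat) (F : groupType) (x : 'I_r -> F) (N : normalSubgroup F).

Definition fox_quotient (i : 'I_r) (w : F) : {malg int[quotient_group N]} :=
  gring_map (@proj F N) (fox_derivative x i << w >>).

Definition magnus_fun (w : F) : {malg 'rV[int]_r[quotient_group N]} :=
  [malg q in \big[fsetU/fset0]_(i < r) msupp (fox_quotient i w) =>
     \row_i (fox_quotient i w)@_q].

Definition magnus (w : F) : wreath 'rV[int]_r (quotient_group N) :=
  (magnus_fun w, proj N w).

Lemma magnus_funE w q : (magnus_fun w)@_q = \row_i (fox_quotient i w)@_q.
Proof.
rewrite mcoeffE; case: ifPn => // /bigfcupP qN; apply/rowP => i; rewrite !mxE.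
rewrite mcoeff_outdom //; apply/negP => qi; apply: qN.
by exists i; rewrite ?mem_index_enum.
Qed.

(* The map induced by magnus on F / N'; see magnus_embeddingE for its         *)
(* independence of the chosen representatives.                                *)
Definition magnus_embedding (g : quotient_group (derived_subgroup N)) :
    wreath 'rV[int]_r (quotient_group N) :=
  magnus (repr g).

Hypothesis x_free : free_basis x.

Lemma fox_quotientM i u v : fox_quotient i (u * v)%g =
  fox_quotient i u + translate (proj N u) (fox_quotient i v).
Proof.
rewrite /fox_quotient (fox_derivativeU _ _ (fox_derivativeP x_free i)).
rewrite /gring_map additive_extD; congr (_ + _).
move: (fox_derivative x i _); apply: eq_additive.
- by move=> a b; rewrite translateD additive_extD.
- by move=> a b; rewrite additive_extD translateD.
- by move=> g; rewrite translateU !additive_extU translateU projM.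
Qed.

Lemma magnusM : {morph magnus : u v / (u * v)%g}.
Proof.
move=> u v; rewrite /magnus wreathM projM; congr pair.
apply/malgP => q; apply/rowP => i; rewrite mcoeffD translateE !magnus_funE !mxE.
by rewrite fox_quotientM mcoeffD translateE.
Qed.

Lemma magnus_derived w : derived_set N w -> magnus w = 1%g.
Proof.
have m1 : magnus 1%g = 1%g by apply: (mulIg (magnus 1%g)); rewrite -magnusM !mul1g.
have mV u : magnus u^-1%g = (magnus u)^-1%g.
  by apply: (mulIg (magnus u)); rewrite -magnusM !mulVg.
apply: (@smallest_sub _ _ _ [set u | magnus u = 1%g]) => [|u /=].
  split=> [//|u v|u] /=; first by rewrite magnusM => -> ->; rewrite mulg1.
  by rewrite mV => ->; rewrite invg1.
move=> [a [b [Na Nb ->]]]; rewrite /commg /conjg !magnusM !mV.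
apply/eqP/commgP; rewrite /commute !wreathM.
have projN c : N c -> proj N c = 1%g.
  by move=> Nc; apply/esym/proj_eqP; rewrite invg1 mul1g.
by rewrite /= !projN // !translate1 addrC.
Qed.

Lemma magnus_embeddingE w :
  magnus_embedding (proj (derived_subgroup N) w) = magnus w.
Proof.
have /magnus_derived := repr_projP (derived_subgroup N) w.
move=> /(congr1 (fun p => (magnus (repr (proj (derived_subgroup N) w)) * p)%g)).
by rewrite mulg1 -magnusM mulVKg => ->.
Qed.

Definition quotient_gens : set (quotient_group (derived_subgroup N)) :=
  [set g | exists i, g = proj (derived_subgroup N) (x i)].

Definition wreath_gens : set (wreath 'rV[int]_r (quotient_group N)) :=
  [set g | exists i, g = (0, proj N (x i))
                  \/ g = (<< delta_mx 0 i *g 1%g >>, 1%g)].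

End MagnusEmbedding.

Arguments quotient_gens {r F} x N _.
Arguments wreath_gens {r F} x N _.

Section WordMetric.
Variables (G : groupType) (S : set G).

Definition has_word_of_length (g : G) (n : nat) : Prop :=
  exists s : seq G, [/\ size s = n,
    forall y, y \in s -> S y \/ S y^-1%g & (\prod_(y <- s) y)%g = g].

(* The default value 0 is taken only outside the subgroup generated by S. *)
Definition word_length (g : G) : nat :=
  if pselect (exists n, `[< has_word_of_length g n >]) is left h
  then ex_minn h else 0.

Definition word_dist (g h : G) : nat := word_length (g^-1 * h)%g.

End WordMetric.

(* Main.v *)
Require Import Defs.
From mathcomp Require Import all_boot all_order all_algebra.
From HB Require Import structures.
From mathcomp Require Import boolp classical_sets zify lra.
From mathcomp.multinomials Require Import monalg.
Import GRing.Theory Num.Theory.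
Local Open Scope ring_scope.

Set Implicit Arguments.
Unset Strict Implicit.
Unset Printing Implicit Defensive.

(** The Magnus image of a word records a flow: in the Cayley graph of F/N, a
    word w traces a path from the identity to theta(w), and the function f^(w)
    counts, with sign, how often that path crosses each edge
    ([magnus_trail]).

    The upper bound is immediate: phi(x_i) = (e_i, Id)(1, x_i N) is a product
    of two generators of the wreath product, so phi at most doubles lengths.

    For the lower bound, take a word of length n over the wreath generators
    with value phi(g) = (f, b).  Its k cursor moves trace a path p from the
    identity to b, and each of its n - k lamp moves changes f by one unit on an
    edge that starts at the current position of the cursor.  So f is the flow
    of a list L of n - k directed edges, each of which has an endpoint on p
    ([wreath_word_trail]).  Add to L the reversals of the edges of p.  The flow
    of the enlarged list is f minus the flow of p; both are flows from the
    identity to b, so the list is balanced at every vertex.  As in Euler's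
    theorem on circuits, a balanced list of directed edges that all touch the
    path p can be inserted into p, each of its edges being used exactly once
    ([trail_absorb]).  The result is a path from the identity to b of length
    k + (n - k) + k <= 2n, whose flow is f because the edges of p cancel with
    their reversals.  Its label is a word u in the x_i with
    phi(u) = (f, b) = phi(g) ([realize_by_word]).

    It remains to see that u = g in F/N', i.e. that phi is injective
    ([magnus_inj_derived]).  Choose a representative s(q) in F/N' of every
    coset q; to the edge from q to q x_i belongs the element
    s(q) x_i s(q x_i)^-1 of the abelian group N/N'.  Along a word w these
    telescope: their product is s(1) w s(theta(w))^-1.  As N/N' is abelian, the
    product depends on f^(w) only, so that f^(w) and theta(w) determine w in
    F/N' ([loop_sumE]). *)

(** * Words in the generators *)

Section Words.
Variable r : nat.

Definition letter_val (G : groupType) (y : 'I_r -> G) (l : 'I_r * bool) : G :=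
  if l.2 then (y l.1)^-1%g else y l.1.

Definition spell (G : groupType) (y : 'I_r -> G) (t : seq ('I_r * bool)) : G :=
  (\prod_(l <- t) letter_val y l)%g.

Lemma spell_nil (G : groupType) (y : 'I_r -> G) : spell y [::] = 1%g.
Proof. by rewrite /spell big_nil. Qed.

Lemma spell_cons (G : groupType) (y : 'I_r -> G) l t :
  spell y (l :: t) = (letter_val y l * spell y t)%g.
Proof. by rewrite /spell big_cons. Qed.

Lemma spell_cat (G : groupType) (y : 'I_r -> G) t1 t2 :
  spell y (t1 ++ t2) = (spell y t1 * spell y t2)%g.
Proof. by rewrite /spell big_cat. Qed.

Lemma spell_rcons (G : groupType) (y : 'I_r -> G) t l :
  spell y (rcons t l) = (spell y t * letter_val y l)%g.
Proof. by rewrite -cats1 spell_cat spell_cons spell_nil mulg1. Qed.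

Lemma morph1g (G H : groupType) (h : G -> H) :
  {morph h : u v / (u * v)%g} -> h 1%g = 1%g.
Proof. by move=> hM; apply: (mulIg (h 1%g)); rewrite -hM !mul1g. Qed.

Lemma morphVg (G H : groupType) (h : G -> H) :
  {morph h : u v / (u * v)%g} -> {morph h : u / u^-1%g}.
Proof.
by move=> hM u; apply: (mulIg (h u)); rewrite -hM !mulVg morph1g.
Qed.

Lemma morph_letter (G H : groupType) (h : G -> H) (y : 'I_r -> G) l :
  {morph h : u v / (u * v)%g} ->
  h (letter_val y l) = letter_val (h \o y) l.
Proof. by move=> hM; rewrite /letter_val; case: l.2; rewrite ?(morphVg hM). Qed.

Lemma morph_spell (G H : groupType) (h : G -> H) (y : 'I_r -> G) t :
  {morph h : u v / (u * v)%g} -> h (spell y t) = spell (h \o y) t.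
Proof.
move=> hM; elim: t => [|l t IH]; first by rewrite !spell_nil morph1g.
by rewrite !spell_cons hM IH morph_letter.
Qed.

End Words.

Section WordLength.
Variables (G : groupType) (S : set G).

Lemma has_word1 : has_word_of_length S 1%g 0.
Proof. by exists [::]; split; rewrite ?big_nil. Qed.

Lemma has_wordM g h m n : has_word_of_length S g m ->
  has_word_of_length S h n -> has_word_of_length S (g * h)%g (m + n).
Proof.
move=> [s [ss sS <-]] [t [st tS <-]]; exists (s ++ t); split.
- by rewrite size_cat ss st.
- by move=> y; rewrite mem_cat => /orP [/sS|/tS].
- by rewrite big_cat.
Qed.

Lemma has_word_gen g : S g -> has_word_of_length S g 1.
Proof.
move=> Sg; exists [:: g]; split; rewrite ?big_seq1 // => y.
by rewrite inE => /eqP ->; left.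
Qed.

Lemma has_wordV g n : has_word_of_length S g n -> has_word_of_length S g^-1%g n.
Proof.
move=> [s [<- sS <-]] {n}; elim: s sS => [|y s IH] sS.
  by rewrite big_nil invg1; apply: has_word1.
rewrite big_cons invgM /= -addn1; apply: has_wordM.
  by apply: IH => z zs; apply: sS; rewrite inE zs orbT.
exists [:: y^-1%g]; split; rewrite ?big_seq1 // => z.
rewrite inE => /eqP ->; rewrite invgK.
by case: (sS y (mem_head _ _)); [right|left].
Qed.

Lemma has_word_word_length g n : has_word_of_length S g n ->
  has_word_of_length S g (word_length S g).
Proof.
move=> gn; rewrite /word_length; case: pselect => [h|[]]; last first.
  by exists n; apply/asboolP.
by case: ex_minnP => m /asboolP.
Qed.

Lemma word_length_le g n : has_word_of_length S g n ->
  (word_length S g <= n)%N.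
Proof.
move=> gn; rewrite /word_length; case: pselect => [h|//].
by case: ex_minnP => m _; apply; apply/asboolP.
Qed.

Lemma word_dist1 g : word_dist S 1%g g = word_length S g.
Proof. by rewrite /word_dist invg1 mul1g. Qed.

End WordLength.

Section LetterWords.
Variables (r : nat) (G : groupType) (y : 'I_r -> G) (S : set G).

Lemma has_word_spell k t : (forall i, has_word_of_length S (y i) k) ->
  has_word_of_length S (spell y t) (k * size t).
Proof.
move=> yS; elim: t => [|[i b] t IH].
  by rewrite spell_nil muln0; apply: has_word1.
rewrite spell_cons /= mulnS; apply: has_wordM => //.
by rewrite /letter_val /=; case: b => //; apply: has_wordV.
Qed.

Lemma spell_has_word g n : (forall z, S z -> exists i, z = y i) ->
  has_word_of_length S g n -> exists2 t, size t = n & spell y t = g.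
Proof.
move=> Sy [s [<- sS <-]]; elim: s sS => [|z s IH] sS.
  by exists [::]; rewrite ?spell_nil ?big_nil.
have [t st tE] : exists2 t, size t = size s & spell y t = (\prod_(u <- s) u)%g.
  by apply: IH => u us; apply: sS; rewrite inE us orbT.
have [l lE] : exists l, letter_val y l = z.
  case: (sS z (mem_head _ _)) => /Sy [i zi]; first by exists (i, false).
  by exists (i, true); rewrite /letter_val /= -zi invgK.
by exists (l :: t); rewrite /= ?st // spell_cons big_cons lE tE.
Qed.

End LetterWords.

Section Generation.
Variables (r : nat) (F : groupType) (x : 'I_r -> F).

Definition spelled : {pred F} := [pred w | `[< exists t, spell x t = w >]].

Lemma spelled_closed : group_closed spelled.
Proof.
split; first by apply/asboolP; exists [::]; rewrite spell_nil.
move=> _ _ /asboolP [t <-] /asboolP [u <-]; apply/asboolP.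
elim/last_ind: u t => [|u [i b] IH] t.
  by exists t; rewrite spell_nil invg1 mulg1.
have [v vE] := IH (rcons t (i, ~~ b)); exists v.
rewrite vE !spell_rcons invgM mulgA /letter_val /=.
by case: b {vE}; rewrite ?invgK.
Qed.

Definition spelled_group := {w | w \in spelled}.
HB.instance Definition _ := SubChoice.on spelled_group.
HB.instance Definition _ :=
  SubChoice_isSubGroup.Build F spelled spelled_group spelled_closed.

(** The universal property yields a homomorphism from F to the subgroup of
    spelled elements that fixes each generator; followed by the inclusion it is
    the identity, by uniqueness, so the subgroup is everything. *)
Lemma free_basis_spell w : free_basis x -> exists t, spell x t = w.
Proof.
move=> x_free.
have xS i : x i \in spelled.
  by apply/asboolP; exists [:: (i, false)]; rewrite spell_cons spell_nil mulg1.
have [h [[hM hx] _]] :=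
  x_free (spelled_group : groupType) (fun i => Sub (x i) (xS i)).
have [k [_ kU]] := x_free _ x.
have <- : val (h w) = w.
  rewrite -[LHS]/((val \o h) w) -(kU (val \o h)) ?(kU id) //.
  by split=> [u v|i] /=; rewrite ?hM ?hx ?SubK //= gmulfM.
by have /asboolP := valP (h w).
Qed.

End Generation.

(** * Balanced edge lists and trails in a directed multigraph *)

Section Trails.
Local Open Scope nat_scope.
Variables (V E : eqType) (src tgt : E -> V).

Fixpoint trail (a : V) (p : seq E) (b : V) : bool :=
  if p is e :: p' then (src e == a) && trail (tgt e) p' b else a == b.

Lemma trail_cat a b c p q : trail a p b -> trail b q c -> trail a (p ++ q) c.
Proof.
elim: p a => [|e p IH] a /=; first by move/eqP->.
by move=> /andP [-> /IH]; apply.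
Qed.

Lemma trail_end a b p : trail a p b -> b \in a :: map tgt p.
Proof.
elim: p a => [|e p IH] a /=; first by move/eqP->; rewrite mem_seq1.
by case/andP => _ /IH ep; rewrite inE ep orbT.
Qed.

Lemma trail_split a b z p : trail a p b -> z \in a :: map tgt p ->
  exists p1 p2, [/\ p = p1 ++ p2, trail a p1 z & trail z p2 b].
Proof.
elim: p a => [|e p IH] a ap.
  by rewrite mem_seq1 => /eqP ->; exists [::], [::]; split=> //=.
rewrite inE => /orP [/eqP ->|zp]; first by exists [::], (e :: p); split=> //=.
have /andP [ea ep] := ap.
have [p1 [p2 [-> ? ?]]] := IH _ ep zp.
by exists (e :: p1), p2; split=> //=; rewrite ea.
Qed.

Lemma trail_balance a b p q : trail a p b ->
  count (fun e => src e == q) p + (b == q) =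
  count (fun e => tgt e == q) p + (a == q).
Proof.
elim: p a => [|e p IH] a /=; first by move/eqP->.
by move=> /andP [/eqP <- /IH]; lia.
Qed.

Definition touches (s : seq V) (e : E) := (src e \in s) || (tgt e \in s).

Lemma all_touchesW (s s' : seq V) L :
  {subset s <= s'} -> all (touches s) L -> all (touches s') L.
Proof.
move=> ss'; apply: sub_all => e; rewrite /touches.
by move=> /orP [] /ss' ->; rewrite ?orbT.
Qed.

(** Here the trail still has a gap from a to b, which the edges of L are to
    bridge; the balance condition says that L is a flow from a to b.  If a
    differs from b, some edge of L leaves a and may be appended to the first
    half.  If a = b, the two halves form one trail; it may be cut again at an
    endpoint of any remaining edge of L, which then prolongs one of the new
    halves into the gap.  Either way L loses an edge, and no vertex of the
    trail is lost. *)
Lemma trail_absorb_gap o a b z (p1 p2 L : seq E) :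
  trail o p1 a -> trail b p2 z ->
  (forall q, count (fun e => src e == q) L + (b == q) =
             count (fun e => tgt e == q) L + (a == q)) ->
  all (touches ((o :: map tgt p1) ++ (b :: map tgt p2))) L ->
  exists2 p, trail o p z & perm_eq p (p1 ++ L ++ p2).
Proof.
move En : (size L) => n; elim: n a b p1 p2 L En => [|n IH] a b p1 p2 L.
  move=> /size0nil -> o1 b2 /(_ b) /=; rewrite eqxx.
  case: eqP => // ab _ _; exists (p1 ++ p2) => //.
  by apply: trail_cat o1 _; rewrite ab.
(* The move for an edge that leaves the end of the first half; its target may
   be anything, so the gap is allowed to open up again. *)
have step a' b' p1' p2' e L' : size L' = n -> src e = a' ->
    trail o p1' a' -> trail b' p2' z ->
    (forall q, count (fun e => src e == q) (e :: L') + (b' == q) =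
               count (fun e => tgt e == q) (e :: L') + (a' == q)) ->
    all (touches ((o :: map tgt p1') ++ (b' :: map tgt p2'))) L' ->
    exists2 p, trail o p z & perm_eq p (p1' ++ (e :: L') ++ p2').
  move=> sL ea o1 b2 bal tch.
  have [||||p op pE] := IH (tgt e) b' (rcons p1' e) p2' L' sL.
  - by rewrite -cats1; apply: trail_cat o1 _; rewrite /= ea !eqxx.
  - by [].
  - by move=> q; move: (bal q); rewrite /= ea; lia.
  - apply: all_touchesW tch => q; rewrite map_rcons !(mem_cat, inE, mem_rcons).
    by case/orP => [/orP [] ->|->]; rewrite ?orbT.
  by exists p => //; rewrite cat_rcons in pE.
move=> sL o1 b2 bal tch; have [ab|ab] := eqVneq a b; last first.
  have : has (fun e => src e == a) L.
    rewrite has_count; move: (bal a); rewrite eqxx.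
    by rewrite (negbTE (_ : b != a)) 1?eq_sym //; lia.
  case/hasP => e eL /eqP ea.
  have LE := perm_to_rem eL.
  have [||||||p op pE] := step a b p1 p2 e (rem e L) => //.
  - by rewrite size_rem // sL.
  - by move=> q; rewrite -!(permP LE).
  - by move: tch; rewrite (perm_all _ LE) => /andP [].
  by exists p => //; rewrite (perm_trans pE) // perm_cat2l perm_cat2r perm_sym.
subst b; case: L sL bal tch => [//|e L] [sL] bal /= /andP [te tL].
have visited q : (q \in (o :: map tgt p1) ++ (a :: map tgt p2)) ->
    (q \in o :: map tgt (p1 ++ p2)).
  have aV := trail_end o1.
  rewrite map_cat -cat_cons !mem_cat => /orP [->//|].
  by rewrite inE => /orP [/eqP ->|->]; rewrite ?aV ?orbT.
have tL' p1' p2' c : p1 ++ p2 = p1' ++ p2' ->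
    all (touches ((o :: map tgt p1') ++ (c :: map tgt p2'))) L.
  move=> pE; apply: all_touchesW tL => q /visited.
  by rewrite pE map_cat !(mem_cat, inE) => /or3P [] ->; rewrite ?orbT.
have finish p1' p2' p : p1 ++ p2 = p1' ++ p2' ->
    perm_eq p (p1' ++ (e :: L) ++ p2') -> perm_eq p (p1 ++ (e :: L) ++ p2).
  move=> pE pp; rewrite (perm_trans pp) //.
  by rewrite perm_catCA perm_sym perm_catCA perm_cat2l pE.
have oz := trail_cat o1 b2.
case/orP: te => /visited /(trail_split oz) [p1' [p2' [pE o1' b2']]].
  have [||||||p op /(finish _ _ _ pE) pp] :=
    step (src e) (src e) p1' p2' e L => //.
  - by move=> q; move: (bal q); lia.
  - exact: tL'.
  by exists p.
have [||||p op pp] := IH (tgt e) (src e) p1' (e :: p2') L sL => //.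
- by rewrite /= eqxx.
- by move=> q; move: (bal q) => /=; lia.
- apply: all_touchesW (tL' _ _ (src e) pE) => q; rewrite !(mem_cat, inE) /=.
  by case/orP => [->|/orP [] ->]; rewrite ?orbT.
exists p => //; apply: (finish _ _ _ pE).
by rewrite (perm_trans pp) // perm_cat2l -cat1s perm_catCA.
Qed.

(** The engine of the lower bound, a relative form of Euler's theorem on
    circuits: no connectedness is asked of L, because each of its edges touches
    the given trail. *)
Lemma trail_absorb a b (p L : seq E) : trail a p b ->
  (forall q, count (fun e => src e == q) L = count (fun e => tgt e == q) L) ->
  all (touches (a :: map tgt p)) L ->
  exists2 p', trail a p' b & perm_eq p' (p ++ L).
Proof.
move=> ab bal tch.
have [||||p' ab' pE] := @trail_absorb_gap a b b b p [::] L => //=.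
- by move=> q; rewrite bal.
- by apply: all_touchesW tch => q; rewrite -cat_cons mem_cat => ->.
by exists p' => //; rewrite cats0 in pE.
Qed.

End Trails.

(** * Flows on a Cayley graph *)

Section CayleyFlow.
Variables (r : nat) (B : groupType) (y : 'I_r -> B).

(** An edge is a vertex with the letter read when leaving it, so that the two
    directions of an edge of the Cayley graph are different elements. *)
Definition edge : Type := (B * ('I_r * bool))%type.
HB.instance Definition _ := Choice.on edge.

Definition esrc (e : edge) : B := e.1.
Definition etgt (e : edge) : B := (e.1 * letter_val y e.2)%g.
Definition rev_edge (e : edge) : edge := (etgt e, (e.2.1, ~~ e.2.2)).

(** Crossing the edge of a generator backwards, through an inverse letter,
    counts as -1 at the vertex where the edge starts, which is then the
    target. *)
Definition edge_flow (e : edge) : {malg 'rV[int]_r[B]} :=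
  if e.2.2 then - << delta_mx 0 e.2.1 *g etgt e >>
  else << delta_mx 0 e.2.1 *g esrc e >>.

Definition flow (p : seq edge) : {malg 'rV[int]_r[B]} :=
  \sum_(e <- p) edge_flow e.

Lemma etgt_rev e : etgt (rev_edge e) = esrc e.
Proof.
by case: e => q [i []]; rewrite /etgt /letter_val /= ?mulgVK ?mulgK.
Qed.

Lemma edge_flow_rev e : edge_flow (rev_edge e) = - edge_flow e.
Proof.
by rewrite /edge_flow etgt_rev; case: e => q [i []]; rewrite /= ?opprK.
Qed.

Lemma flow_cat p1 p2 : flow (p1 ++ p2) = flow p1 + flow p2.
Proof. exact: big_cat. Qed.

Lemma flow_rev p : flow (map rev_edge p) = - flow p.
Proof.
rewrite /flow big_map -sumrN; apply: eq_bigr => e _; exact: edge_flow_rev.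
Qed.

Lemma flow_perm p1 p2 : perm_eq p1 p2 -> flow p1 = flow p2.
Proof. exact: perm_big. Qed.

Definition outdeg (p : seq edge) (q : B) := count (fun e => esrc e == q) p.
Definition indeg (p : seq edge) (q : B) := count (fun e => etgt e == q) p.

Lemma outdeg_rev p q : outdeg (map rev_edge p) q = indeg p q.
Proof. by rewrite /outdeg count_map. Qed.

Lemma indeg_rev p q : indeg (map rev_edge p) q = outdeg p q.
Proof.
by rewrite /indeg count_map; apply: eq_count => e /=; rewrite etgt_rev.
Qed.

(** Inflow minus outflow at q, when the i-th coordinate of c at a vertex is the
    amount carried by the i-th edge that starts there. *)
Definition divergence (c : {malg 'rV[int]_r[B]}) (q : B) : int :=
  \sum_i (c@_(q * (y i)^-1)%g 0 i - c@_q 0 i).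

Lemma divergenceD c d q :
  divergence (c + d) q = divergence c q + divergence d q.
Proof.
rewrite -big_split; apply: eq_bigr => i _.
by rewrite !mcoeffD !mxE opprD addrACA.
Qed.

Lemma divergenceN c q : divergence (- c) q = - divergence c q.
Proof.
by rewrite -sumrN; apply: eq_bigr => i _; rewrite !mcoeffN !mxE opprB opprK addrC.
Qed.

Lemma divergenceU i p q :
  divergence << delta_mx 0 i *g p >> q =
  ((p * y i)%g == q)%:R - (p == q)%:R.
Proof.
rewrite /divergence (bigD1 i) //= big1 => [|j ji]; last first.
  by rewrite !mcoeffU !mulmxnE !mxE (negbTE ji) andbF !mul0rn subr0.
rewrite addr0 !mcoeffU !mulmxnE !mxE !eqxx /=; congr (_%:R - _).
by congr nat_of_bool; apply/eqP/eqP => [->|<-]; rewrite ?mulgVK ?mulgK.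
Qed.

Lemma divergence_edge e q :
  divergence (edge_flow e) q = (etgt e == q)%:R - (esrc e == q)%:R.
Proof.
rewrite /edge_flow; case: e => p [i []]; rewrite /etgt /letter_val /=.
  by rewrite divergenceN divergenceU mulgVK opprB.
by rewrite divergenceU.
Qed.

(** The balance of an edge list depends on its flow only; this is how equality
    of two flows turns into a count of edges. *)
Lemma divergence_flow p q :
  divergence (flow p) q = (indeg p q)%:R - (outdeg p q)%:R.
Proof.
rewrite /indeg /outdeg; elim: p => [|e p IH] /=.
  by rewrite /flow big_nil /divergence big1 // => i _; rewrite !mcoeff0 mxE subrr.
rewrite /flow big_cons divergenceD IH divergence_edge !natrD opprD.
by rewrite addrACA.
Qed.

Lemma trail_spell a t :
  exists2 p, trail esrc etgt a p (a * spell y t)%g & map snd p = t.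
Proof.
elim: t a => [|l t IH] a; first by exists [::]; rewrite //= spell_nil mulg1.
have [p ap pt] := IH (a * letter_val y l)%g.
by exists ((a, l) :: p); rewrite /= ?pt // eqxx spell_cons mulgA.
Qed.

End CayleyFlow.

(** * Injectivity of the Magnus embedding *)

Lemma proj1P (F : groupType) (N : normalSubgroup F) g :
  proj N g = 1%g <-> N g.
Proof.
split=> [/esym/proj_eqP|Ng]; first by rewrite invg1 mul1g.
by apply/esym/proj_eqP; rewrite invg1 mul1g.
Qed.

(** The relation module N/N', realized inside F/N' and written additively, so
    that integer multiples of its elements make sense. *)
Section RelationModule.
Variables (F : groupType) (N : normalSubgroup F).
Local Notation Gamma := (quotient_group (derived_subgroup N)).
Local Notation p := (proj (derived_subgroup N)).

Definition in_relmod : {pred Gamma} :=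
  [pred z | `[< exists2 n, N n & p n = z >]].

Lemma in_relmodP z : reflect (exists2 n, N n & p n = z) (z \in in_relmod).
Proof. exact: asboolP. Qed.

Definition relmod := {z : Gamma | z \in in_relmod}.
HB.instance Definition _ := SubChoice.on relmod.

Lemma in_relmod_closed : group_closed in_relmod.
Proof.
split; first by apply/in_relmodP; exists 1%g => //; apply: normal1.
move=> _ _ /in_relmodP [a Na <-] /in_relmodP [b Nb <-]; apply/in_relmodP.
exists (a / b)%g; first by apply: normalM => //; apply: normalV.
by rewrite projM (morphVg (@projM _ _)).
Qed.

HB.instance Definition _ :=
  SubChoice_isSubGroup.Build Gamma in_relmod relmod in_relmod_closed.

Lemma relmod_mulC : commutative (fun u v : relmod => (u * v)%g).
Proof.
move=> u v; apply: val_inj.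
have /in_relmodP [a Na aE] := valP u; have /in_relmodP [b Nb bE] := valP v.
change (val u * val v = val v * val u)%g; rewrite -aE -bE.
rewrite -!projM; apply/esym/proj_eqP => H [_]; apply => /=.
by exists a, b; split=> //; rewrite invgM /commg /conjg !mulgA.
Qed.

HB.instance Definition _ := GRing.isZmodule.Build relmod
  (@mulgA relmod) relmod_mulC (@mul1g relmod) (@mulVg relmod).

Lemma val_relmodD (u v : relmod) : val (u + v) = (val u * val v)%g.
Proof. exact: (@gmulfM _ _ val). Qed.

End RelationModule.

Section MagnusKernel.
Variables (r : nat) (F : groupType) (x : 'I_r -> F) (x_free : free_basis x).
Variable N : normalSubgroup F.
Local Notation p := (proj (derived_subgroup N)).
Local Notation theta := (proj N).

Lemma fox_quotient_gen i j :
  fox_quotient x N i (x j) = if j == i then << 1%g >> else 0.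
Proof.
have [_ _ Dx] := fox_derivativeP x_free i.
rewrite /fox_quotient Dx /gring_map; case: eqP => _; last first.
  by rewrite /additive_ext msupp0 big_nil.
by rewrite additive_extU; congr << _ >>; apply/morph1g/projM.
Qed.

(** The element s(q) x_i s(q x_i)^-1, for the section s of F/N' -> F/N that
    picks representatives, goes around the edge from q to q x_i; it maps to 1
    in F/N. *)
Lemma edge_loop_in (q : quotient_group N) i :
  p (repr q * x i * (repr (q * theta (x i))%g)^-1)%g \in in_relmod (N := N).
Proof.
apply/in_relmodP; eexists; last by [].
apply/proj1P; rewrite !projM (morphVg (@projM _ _)).
by rewrite /proj !reprK mulgV.
Qed.

Definition edge_loop q i : relmod N :=
  exist (fun z => is_true (z \in in_relmod (N := N))) _ (edge_loop_in q i).

(** The product of the edge elements with the multiplicities prescribed by the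
    Magnus image of w. *)
Definition loop_sum (w : F) : relmod N :=
  \sum_i additive_ext (fun q => edge_loop q i) (fox_quotient x N i w).

Lemma loop_sumM_gen w j :
  loop_sum (w * x j)%g = loop_sum w + edge_loop (theta w) j.
Proof.
rewrite /loop_sum.
under eq_bigr => i _ do
  rewrite (fox_quotientM N x_free) additive_extD fox_quotient_gen.
rewrite big_split /=; congr (_ + _); rewrite (bigD1 j) //= eqxx translateU mulg1.
rewrite additive_extU big1 ?addr0 // => i; rewrite eq_sym => /negbTE ->.
by rewrite translate0 /additive_ext msupp0 big_nil.
Qed.

(** The right-hand side determines w in F/N', whereas the left-hand side sees
    only the Magnus image of w. *)
Lemma loop_sumE w :
  (val (loop_sum w) * p (repr (theta w)) = p (repr (theta 1%g)) * p w)%g.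
Proof.
have [t <-] := free_basis_spell w x_free.
pose P w := (val (loop_sum w) * p (repr (theta w)) =
             p (repr (theta 1%g)) * p w)%g.
(* An equivalence, so that it serves for the inverse letters too. *)
have PM u j : P (u * x j)%g <-> P u.
  rewrite /P loop_sumM_gen val_relmodD /= !projM (morphVg (@projM _ _)).
  by rewrite !mulgA mulgVK; split=> [/mulIg|->].
have P1 : P 1%g.
  rewrite /P (_ : loop_sum 1%g = 0).
    by rewrite (morph1g (@projM _ (derived_subgroup N))) mulg1 mul1g.
  rewrite /loop_sum big1 // => i _.
  have : fox_quotient x N i (1 * 1)%g = fox_quotient x N i 1%g by rewrite mulg1.
  rewrite (fox_quotientM N x_free) (morph1g (@projM _ _)) translate1.
  move/eqP; rewrite -subr_eq0 addrK => /eqP ->.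
  by rewrite /additive_ext msupp0 big_nil.
rewrite -/(P _); move: P PM P1 => P PM P1.
elim/last_ind: t => [|t [i b] IH]; first by rewrite spell_nil.
rewrite spell_rcons /letter_val /=; case: b; last exact/PM.
by apply/(PM _ i); rewrite mulgVK.
Qed.

(** Magnus's theorem that the kernel is N', in the form of injectivity on
    F/N'. *)
Lemma magnus_inj_derived w w' : magnus x N w = magnus x N w' -> p w = p w'.
Proof.
move=> ww'; have fE : magnus_fun x N w = magnus_fun x N w' := congr1 fst ww'.
have tE : theta w = theta w' := congr1 snd ww'.
have lE : loop_sum w = loop_sum w'.
  apply: eq_bigr => i _; congr additive_ext; apply/malgP => q.
  have := congr1 (fun c : {malg 'rV[int]_r[quotient_group N]} => c@_q 0 i) fE.
  by rewrite !magnus_funE !mxE.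
apply: (mulgI (p (repr (theta 1%g)))); rewrite -!loop_sumE.
by rewrite lE tE.
Qed.

End MagnusKernel.

(** * Magnus images as flows *)

Section Magnus.
Variables (r : nat) (F : groupType) (x : 'I_r -> F) (x_free : free_basis x).
Variable N : normalSubgroup F.

Local Notation y := (proj N \o x).
Local Notation cayley_trail := (trail (@esrc _ _) (etgt y)).
Local Notation touching := (touches (@esrc _ _) (etgt y)).
Local Notation W := (wreath 'rV[int]_r (quotient_group N)).

Lemma magnus_gen j :
  magnus x N (x j) = (<< delta_mx 0 j *g 1%g >>, y j).
Proof.
congr pair; apply/malgP => q; apply/rowP => i.
rewrite magnus_funE mcoeffU mulmxnE !mxE (fox_quotient_gen x_free) eq_sym eqxx /=.
by case: eqP => _; rewrite ?mcoeffU ?mcoeff0 ?mul0rn.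
Qed.

Lemma magnus_letter l :
  magnus x N (letter_val x l) = (edge_flow y (1%g, l), letter_val y l).
Proof.
rewrite (morph_letter _ _ (magnusM N x_free)) /letter_val /edge_flow.
case: l => i [] /=; rewrite magnus_gen //; congr pair => /=.
by rewrite translateU mulg1 /etgt /= mul1g.
Qed.

Lemma translate_edge_flow a b l :
  translate a (edge_flow y (b, l)) = edge_flow y ((a * b)%g, l).
Proof.
rewrite /edge_flow; case: l => i [] /=; last exact: translateU.
by rewrite translateN translateU /etgt /= mulgA.
Qed.

(** Left multiplication by (0, a) translates the path from 1 to a, which lets
    the induction pass to the path without its first edge. *)
Lemma magnus_trail a p b : cayley_trail a p b ->
  (((0, a) : W) * magnus x N (spell x (map snd p)))%g = (flow y p, b).
Proof.
elim: p a => [|[c l] p IH] a.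
  move=> /eqP ->; rewrite spell_nil (morph1g (magnusM N x_free)) mulg1.
  by rewrite /flow big_nil.
move=> /andP [/eqP <- /IH IHp].
rewrite [map _ _]/= spell_cons (magnusM N x_free) magnus_letter mulgA.
have -> : (((0, c) : W) * ((edge_flow y (1%g, l), letter_val y l) : W))%g =
    (((edge_flow y (c, l), 1%g) : W) * ((0, etgt y (c, l)) : W))%g.
  by rewrite !wreathM /= translate_edge_flow translate0 mulg1 add0r addr0 mul1g.
rewrite -mulgA IHp wreathM /= translate1 mul1g.
by rewrite /flow big_cons.
Qed.

(** The cursor moves of a wreath word trace the trail p, its lamp moves make up
    the edge list L: a lamp move at b adds plus or minus one on an edge that
    starts at b. *)
Lemma wreath_word_trail s :
  (forall z, z \in s -> wreath_gens x N z \/ wreath_gens x N z^-1%g) ->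
  exists p L b, [/\ (size p + size L)%N = size s,
    cayley_trail 1%g p b,
    all (touching (1%g :: map (etgt y) p)) L
    & (\prod_(z <- s) z)%g = (flow y L, b)].
Proof.
elim/last_ind: s => [|s z IH] sS.
  exists [::], [::], 1%g; split; rewrite //= ?eqxx // big_nil /flow.
  by rewrite big_nil.
have [p [L [b [szE pb Lp sE]]]] : exists p L b, [/\ (size p + size L)%N = size s,
    cayley_trail 1%g p b,
    all (touching (1%g :: map (etgt y) p)) L
    & (\prod_(z <- s) z)%g = (flow y L, b)].
  by apply: IH => u us; apply: sS; rewrite mem_rcons inE us orbT.
have bp : b \in 1%g :: map (etgt y) p by apply: trail_end pb.
have [[l ->]|[e [e1 ->]]] : (exists l, z = (0, letter_val y l)) \/
    exists e, touching [:: 1%g] e /\ z = (edge_flow y e, 1%g).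
- have zs : z \in rcons s z by rewrite mem_rcons mem_head.
  have [[i [->|->]]|[i [zE|zE]]] := sS z zs.
  + by left; exists (i, false).
  + by right; exists (1%g, (i, false)); rewrite /touches mem_seq1 eqxx.
  + rewrite -[z]invgK zE; left; exists (i, true).
    by congr pair; rewrite /= translate0 oppr0.
  (* The lamp is decreased by crossing its edge backwards, towards 1. *)
  + rewrite -[z]invgK zE; right; exists (rev_edge y (1%g, (i, false))).
    rewrite edge_flow_rev /touches etgt_rev !mem_seq1 eqxx orbT; split=> //.
    by congr pair; rewrite /= ?invg1 ?translate1.
- exists (rcons p (b, l)), L, (b * letter_val y l)%g; split.
  + by rewrite !size_rcons -szE.
  + by rewrite -cats1; apply: trail_cat pb _; rewrite /= !eqxx.
  + apply: all_touchesW Lp => q; rewrite map_rcons -rcons_cons.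
    by rewrite mem_rcons inE orbC => ->.
  + by rewrite -cats1 big_cat big_seq1 /= sE wreathM /= translate0 addr0.
- exists p, ((b * e.1, e.2)%g :: L), b; split=> //.
  + by rewrite size_rcons -szE /= addnS.
  + rewrite /= Lp andbT /touches /etgt /esrc /= -mulgA.
    move: e1; rewrite /touches /etgt /esrc !mem_seq1.
    by case/orP => /eqP ->; rewrite mulg1 bp ?orbT.
  + rewrite -cats1 big_cat big_seq1 /= sE wreathM /= mulg1.
    rewrite [in RHS]/flow big_cons addrC; congr (_ + _, _).
    by case: e {e1} => q l; rewrite translate_edge_flow.
Qed.

(** The trail absorbs L and the reversals of its own edges.  The latter cancel
    its flow, so that the flow of L remains. *)
Lemma realize_by_word s w :
  (forall z, z \in s -> wreath_gens x N z \/ wreath_gens x N z^-1%g) ->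
  (\prod_(z <- s) z)%g = magnus x N w ->
  exists2 t, (size t <= 2 * size s)%N & magnus x N (spell x t) = magnus x N w.
Proof.
move=> sS sw; have [p [L [b [szE pb Lp sE]]]] := wreath_word_trail sS.
(* A second trail k with the flow of L, read off w itself, shows that the
   divergence of L is that of a trail from 1 to b. *)
have [u uE] := free_basis_spell w x_free.
have [k kb kE] := trail_spell y 1%g u.
have m1 w' : (((0, 1%g) : W) * w')%g = w' by exact: mul1g.
have := magnus_trail kb; rewrite m1 kE uE -sw sE => -[fk bE].
have [|q||p' p'b pE] := @trail_absorb _ _ (@esrc _ _) (etgt y) 1%g b p
  (L ++ map (rev_edge y) p) => //.
- have pbal : (outdeg p q + (b == q) = indeg y p q + (1%g == q))%N :=
    trail_balance q pb.
  have kbal : (outdeg k q + (b == q) = indeg y k q + (1%g == q))%N.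
    by rewrite bE; exact: trail_balance q kb.
  have := divergence_flow y L q; rewrite fk divergence_flow !natz => Lbal.
  rewrite !count_cat -/(outdeg L q) -/(outdeg (map _ p) q) outdeg_rev.
  rewrite -/(indeg y L q) -/(indeg y (map _ p) q) indeg_rev; lia.
- rewrite all_cat Lp all_map; apply/allP => e ep /=; apply/orP; left.
  by rewrite inE; apply/orP; right; apply: (map_f (etgt y)).
exists (map snd p'); last first.
  rewrite -[LHS]m1 (magnus_trail p'b) (flow_perm y pE) !flow_cat flow_rev.
  by rewrite addrC subrK.
rewrite size_map (perm_size pE) !size_cat size_map -szE.
by rewrite mul2n -addnn addnA leq_add2l leq_addr.
Qed.

End Magnus.

(** * Comparison of the word lengths *)

Section Comparison.
Variables (r : nat) (F : groupType) (x : 'I_r -> F) (x_free : free_basis x).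
Variable N : normalSubgroup F.
Local Notation p := (proj (derived_subgroup N)).
Local Notation W := (wreath 'rV[int]_r (quotient_group N)).

Lemma magnus_has_word g n : has_word_of_length (quotient_gens x N) g n ->
  has_word_of_length (wreath_gens x N) (magnus_embedding x g) (2 * n).
Proof.
case/(spell_has_word (y := p \o x)) => [z [i ->]|t <- <-]; first by exists i.
rewrite -(morph_spell _ _ (@projM _ _)) (magnus_embeddingE N x_free).
rewrite (morph_spell _ _ (magnusM N x_free)); apply: has_word_spell => i /=.
(* phi(x_i) = (e_i, 1)(0, x_i) *)
rewrite (_ : magnus x N (x i) =
    ((<< delta_mx 0 i *g 1%g >>, 1%g) : W) * ((0, proj N (x i)) : W))%g; last first.
  by rewrite (magnus_gen x_free) wreathM /= translate0 addr0 mul1g.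
apply: (@has_wordM _ _ _ _ 1 1); apply: has_word_gen; exists i; last by left.
by right.
Qed.

Lemma quotient_has_word g n :
  has_word_of_length (wreath_gens x N) (magnus_embedding x g) n ->
  exists2 m, (m <= 2 * n)%N & has_word_of_length (quotient_gens x N) g m.
Proof.
have [w ->] := proj_surj g; rewrite (magnus_embeddingE N x_free).
move=> [s [<- sS sw]]; have [t tn tw] := realize_by_word x_free sS sw.
exists (size t) => //; rewrite -(magnus_inj_derived x_free tw).
rewrite (morph_spell _ _ (@projM _ _)) -[size t]mul1n.
by apply: has_word_spell => i; apply: has_word_gen; exists i.
Qed.

Lemma exists_word (g : quotient_group (derived_subgroup N)) :
  exists n, has_word_of_length (quotient_gens x N) g n.
Proof.
have [w ->] := proj_surj g; have [t <-] := free_basis_spell w x_free.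
exists (1 * size t)%N; rewrite (morph_spell _ _ (@projM _ _)).
by apply: has_word_spell => i; apply: has_word_gen; exists i.
Qed.

End Comparison.

Theorem theorem1 (r : nat) (r_gt0 : (0 < r)%N) (F : groupType)
    (x : 'I_r -> F) (x_free : free_basis x) (N : normalSubgroup F)
    (g : quotient_group (derived_subgroup N)) :
  (1 / 2 : rat) * (word_dist (quotient_gens x N) 1%g g)%:R
    <= (word_dist (wreath_gens x N) 1%g (magnus_embedding x g))%:R
    <= (2 : rat) * (word_dist (quotient_gens x N) 1%g g)%:R.
Proof.
rewrite !word_dist1.
have [n /has_word_word_length gw] := exists_word x_free g.
have Mw := magnus_has_word x_free gw.
have [m m_le /word_length_le gm] :=
  quotient_has_word x_free (has_word_word_length Mw).
have upper := word_length_le Mw; have lower := leq_trans gm m_le.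
rewrite -(ler_nat rat) natrM in upper; rewrite -(ler_nat rat) natrM in lower.
by apply/andP; split; lra.
Qed.
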